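(* Let $F:\mathbb{R}^n\rightrightarrows\mathbb{R}^q$ be a polyhedral convex set-valued mapping with recession mapping $G$ and natural ordering cone $K$, and let $C\subseteq\mathbb{R}^q$ be a polyhedral convex cone which is regular for $F$. Let $\mathcal{Q} = C+\bigcup_{x\in\mathbb{R}^n}G(x)$. Then the polyhedral convex set optimization problem (P), $\min F(x)+C$ s.t. $x\in\mathbb{R}^n$, has a solution if and only if (P) is feasible, $$(-C)\cap\mathcal{Q}\subseteq C \qquad\text{and}\qquad C\supseteq K.$$
   Context: A set-valued mapping $F:\mathbb{R}^n\rightrightarrows\mathbb{R}^q$ assigns to each $x\in\mathbb{R}^n$ a (possibly empty) subset $F(x)\subseteq\mathbb{R}^q$; $\operatorname{gr}F=\{(x,y): y\in F(x)\}$ and $\operatorname{dom}F=\{x: F(x)\neq\emptyset\}$. $F$ is polyhedral convex if $\operatorname{gr}F$ is a convex polyhedron. A polyhedral convex cone is nonempty (contains $0$). The recession cone of a convex polyhedron $P$ is $0^+P=\{d: p+td\in P\ \forall p\in P,\ t\ge 0\}$. The recession mapping of $F$ is $G:\mathbb{R}^n\rightrightarrows\mathbb{R}^q$ with $\operatorname{gr}G=0^+\operatorname{gr}F$. The natural ordering cone of $F$ is $K=K_F=\{y\in\mathbb{R}^q : \exists x\in\mathbb{R}^n:\ y\in G(x),\ 0\in G(x)\}$. A polyhedral convex cone $C\subseteq\mathbb{R}^q$ is regular for $F$ if $\operatorname{lin}C\subseteq G(0)\subseteq C$, where $\operatorname{lin}C=C\cap(-C)$. Problem (P), given by $F$ and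 the ordering cone $C$: minimize $F(x)+C$ over $x\in\mathbb{R}^n$ with respect to $\supseteq$. It is feasible if $\operatorname{dom}F\ne\emptyset$. Its upper image is $\mathcal{P}=C+\bigcup_{x\in\mathbb{R}^n}F(x)$. Solution concept. $\operatorname{conv}$ is the convex hull; $\operatorname{cone}Y$ is the smallest convex cone containing $Y$, with $\operatorname{cone}\emptyset=\{0\}$. - A pair $(\bar S,\hat S)$ of finite sets $\bar S\subseteq\operatorname{dom}F$, $\bar S\ne\emptyset$, $\hat S\subseteq\operatorname{dom}G\setminus\{0\}$ is a finite infimizer for (P) if $\mathcal{P}\subseteq C+\operatorname{conv}\bigcup_{x\in\bar S}F(x)+\operatorname{cone}\bigcup_{x\in\hat S}G(x)$. - $\bar x\in\operatorname{dom}F$ is a minimizing point for (P) if there is no $x\in\mathbb{R}^n$ with $F(x)+C\supsetneq F(\bar x)+C$. - A nonzero $\hat x\in\operatorname{dom}G$ is a minimizing direction for (P) if there is no $x\in\mathbb{R}^n$ with $G(x)+C\supsetneq G(\hat x)+C$. - A finite infimizer $(\bar S,\hat S)$ is a solution to (P) if all elements of $\bar S$ are minimizing points and all elements of $\hat S$ (if any) are minimizing directions. *)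

(* Defs.v *)
From mathcomp Require Import all_boot all_order all_algebra.
From mathcomp Require Import boolp classical_sets cardinality reals convex.

Set Implicit Arguments.
Unset Strict Implicit.
Unset Printing Implicit Defensive.

Import Order.TTheory GRing.Theory Num.Theory.

Local Open Scope classical_set_scope.
Local Open Scope ring_scope.

(* Minkowski sum; it is empty as soon as one of the summands is. *)
Definition minkowski_sum (V : zmodType) (A B : set V) : set V :=
  [set x + y | x in A & y in B].

Notation "A :+: B" := (minkowski_sum A B)
  (at level 50, left associativity) : classical_set_scope.

Definition set_opp (V : zmodType) (A : set V) : set V := [set - x | x in A].

Section convex.
Variables (R : realType) (V : lmodType R).
Implicit Types A Y : set V.

Definition convex_hull Y : set V := smallest (@convex_set R V) Y.

Definition convex_cone A : Prop :=
  [/\ A 0, @convex_set R V A &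
      forall (t : R) (x : V), 0 <= t -> A x -> A (t *: x)].

(* Convex cones contain 0, hence [cone_hull set0] is [[set 0]]. *)
Definition cone_hull Y : set V := smallest convex_cone Y.

(* [lin C] *)
Definition lineality A : set V := A `&` set_opp A.

Definition recession_cone A : set V :=
  [set d | forall p (t : R), A p -> 0 <= t -> A (p + t *: d)].

End convex.

(* A finite, possibly empty, intersection of closed half-spaces: the empty set
   (as the solution set of 0 <= -1) and the whole space (m = 0) are included. *)
Definition polyhedron (R : realType) (p : nat) (P : set 'cV[R]_p) : Prop :=
  exists (m : nat) (A : 'M[R]_(m, p)) (b : 'cV[R]_m),
    P = [set x | forall i, (A *m x) i 0 <= b i 0].

Definition polyhedral_cone (R : realType) (p : nat) (C : set 'cV[R]_p) : Prop :=
  polyhedron C /\ convex_cone C.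

Section set_valued_maps.
Variables (R : realType) (n q : nat).
Implicit Types (F : 'cV[R]_n -> set 'cV[R]_q) (C : set 'cV[R]_q).

(* R^n x R^q is identified with R^(n + q): the pair (x, y) is [col_mx x y]. *)
Definition graph F : set 'cV[R]_(n + q) :=
  [set z | F (usubmx z) (dsubmx z)].

Definition dom F : set 'cV[R]_n := [set x | F x !=set0].

Definition polyhedral_convex F : Prop := polyhedron (graph F).

(* The mapping whose graph is the recession cone of [graph F]. *)
Definition recession_map F : 'cV[R]_n -> set 'cV[R]_q :=
  fun x => [set y | recession_cone (graph F) (col_mx x y)].

Lemma graph_recession_map F :
  graph (recession_map F) = recession_cone (graph F).
Proof.
by apply/seteqP; split=> z; rewrite /graph /recession_map /= vsubmxK.
Qed.

Definition natural_cone F : set 'cV[R]_q :=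
  [set y | exists x, recession_map F x y /\ recession_map F x 0].

Definition regular F C : Prop :=
  lineality C `<=` recession_map F 0 /\ recession_map F 0 `<=` C.

Definition feasible F : Prop := dom F !=set0.

Definition upper_image F C : set 'cV[R]_q := C :+: \bigcup_x F x.

Definition finite_infimizer F C (Sp Sd : set 'cV[R]_n) : Prop :=
  [/\ finite_set Sp /\ finite_set Sd,
      Sp `<=` dom F /\ Sp !=set0,
      Sd `<=` dom (recession_map F) `\ 0 &
      upper_image F C `<=`
        C :+: convex_hull (\bigcup_(x in Sp) F x)
          :+: cone_hull (\bigcup_(x in Sd) recession_map F x)].

Definition minimizing_point F C (xb : 'cV[R]_n) : Prop :=
  dom F xb /\ ~ exists x, F xb :+: C `<` F x :+: C.

Definition minimizing_direction F C (xh : 'cV[R]_n) : Prop :=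
  [/\ xh != 0, dom (recession_map F) xh &
      ~ exists x, recession_map F xh :+: C `<` recession_map F x :+: C].

Definition solution F C (Sp Sd : set 'cV[R]_n) : Prop :=
  [/\ finite_infimizer F C Sp Sd,
      forall x, Sp x -> minimizing_point F C x &
      forall x, Sd x -> minimizing_direction F C x].

End set_valued_maps.

(* Main.v *)
(* The conditions on the right-hand side are equivalent to: whenever [G x] meets
   [-C], it is contained in [C].  If [xb] is a minimizing point and [y] lies in
   [G x] and in [-C], then [F (xb + t x) + C] contains [F xb + C] for [t >= 0],
   so both are equal, hence [F xb + C] recedes in all the directions of [G x],
   that is, these directions are in [G 0 + C = C].

   Conversely, elimination of variables gives
   [F x + C = {y | a_j x + l_j y <= beta_j for all j}], and [G x + C] is given
   by the same inequalities with right-hand sides [0].  Starting from any [x0] in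
   the domain, maximize [l_j y] for one [j] after the other over the pairs
   [(x, y)] with [y] in [F x + C] and [F x + C] containing [F x' + C], where [x']
   is the current point; the condition on [G] says that no recession direction
   improves the objective, so the maximum exists.  The last point found is
   minimizing and dominates [x0].  Applied to the generators of the graph of [F]
   (to [F] for the points and to [G] for the directions) this gives a solution. *)

Require Import Defs.
From mathcomp Require Import all_boot all_order all_algebra.
From mathcomp Require Import boolp classical_sets cardinality reals convex.
From mathcomp Require Import interval_inference.
From mathcomp Require Import ring lra.

Set Implicit Arguments.
Unset Strict Implicit.
Unset Printing Implicit Defensive.

Import Order.TTheory GRing.Theory Num.Theory.

Local Open Scope classical_set_scope.
Local Open Scope ring_scope.

(** * The scalar product of column vectors *)

Section Dot.
Variables (R : realType).

Definition dotp p (a x : 'cV[R]_p) : R := (a^T *m x) 0 0.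

Lemma dotpE p (a x : 'cV[R]_p) : dotp a x = \sum_i a i 0 * x i 0.
Proof. by rewrite /dotp mxE; apply: eq_bigr => i _; rewrite mxE. Qed.

Lemma dotpC p (a x : 'cV[R]_p) : dotp a x = dotp x a.
Proof. by rewrite !dotpE; apply: eq_bigr => i _; rewrite mulrC. Qed.

Lemma dotpDr p (a x y : 'cV[R]_p) : dotp a (x + y) = dotp a x + dotp a y.
Proof. by rewrite /dotp mulmxDr mxE. Qed.

Lemma dotpZr p (a x : 'cV[R]_p) t : dotp a (t *: x) = t * dotp a x.
Proof. by rewrite /dotp -scalemxAr mxE. Qed.

Lemma dotp0r p (a : 'cV[R]_p) : dotp a 0 = 0.
Proof. by rewrite -(scale0r 0) dotpZr mul0r. Qed.

Lemma dotpNr p (a x : 'cV[R]_p) : dotp a (- x) = - dotp a x.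
Proof. by rewrite -scaleN1r dotpZr mulN1r. Qed.

Lemma dotpDl p (a b x : 'cV[R]_p) : dotp (a + b) x = dotp a x + dotp b x.
Proof. by rewrite !(dotpC _ x) dotpDr. Qed.

Lemma dotpZl p (a x : 'cV[R]_p) t : dotp (t *: a) x = t * dotp a x.
Proof. by rewrite !(dotpC _ x) dotpZr. Qed.

Lemma dotp0l p (x : 'cV[R]_p) : dotp 0 x = 0.
Proof. by rewrite dotpC dotp0r. Qed.

Lemma dotpNl p (a x : 'cV[R]_p) : dotp (- a) x = - dotp a x.
Proof. by rewrite !(dotpC _ x) dotpNr. Qed.

Lemma dotp_col p r (a x : 'cV[R]_p) (b y : 'cV[R]_r) :
  dotp (col_mx a b) (col_mx x y) = dotp a x + dotp b y.
Proof. by rewrite /dotp tr_col_mx mul_row_col mxE. Qed.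

Lemma dotp_delta p (i : 'I_p) (x : 'cV[R]_p) : dotp (delta_mx i 0) x = x i 0.
Proof. by rewrite /dotp trmx_delta -rowE mxE. Qed.

Lemma dotp_row m p (A : 'M[R]_(m, p)) i x : dotp (row i A)^T x = (A *m x) i 0.
Proof. by rewrite /dotp trmxK -row_mul mxE. Qed.

End Dot.

(** * Finitely generated and finitely constrained cones: the Minkowski-Weyl theorem *)

Section Cones.
Variables (R : realType) (p : nat).
Implicit Types (h s : seq 'cV[R]_p) (e x : 'cV[R]_p).

Definition hcone h : set 'cV[R]_p := [set x | forall a, a \in h -> dotp a x <= 0].

(** Nonnegative combinations, built one generator at a time so that [hcone_add_ray] can be
    iterated. *)
Fixpoint gcone s : set 'cV[R]_p :=
  if s is e :: s' then
    [set x | exists t y, [/\ 0 <= t, gcone s' y & x = t *: e + y]]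
  else [set 0].

(** Fourier-Motzkin elimination of [t]: constraints with [dotp a e <= 0] are kept, and each pair of
    constraints of opposite strict signs on [e] contributes its positive combination vanishing at
    [e]. *)
Lemma hcone_add_ray h e : exists h', forall x,
  hcone h' x <-> exists t y, [/\ 0 <= t, hcone h y & x = t *: e + y].
Proof.
pose pos := [seq a <- h | 0 < dotp a e]; pose neg := [seq a <- h | dotp a e < 0].
exists ([seq a <- h | dotp a e <= 0] ++
  [seq (- dotp b e) *: a + dotp a e *: b | a <- pos, b <- neg]) => x; split.
- move=> hx.
  have hx1 a : a \in h -> dotp a e <= 0 -> dotp a x <= 0.
    by move=> ah ae; apply: hx; rewrite mem_cat mem_filter ae ah.
  have hx2 a b : a \in pos -> b \in neg ->
      dotp a x / dotp a e <= dotp b x / dotp b e.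
    move=> ap bn.
    have : dotp ((- dotp b e) *: a + dotp a e *: b) x <= 0.
      apply: hx; rewrite mem_cat; apply/orP; right.
      by apply/allpairsP; exists (a, b).
    move: ap bn; rewrite !mem_filter => /andP[a0 _] /andP[b0 _].
    rewrite dotpDl !dotpZl => le0.
    rewrite ler_pdivrMr // mulrAC ler_ndivlMr //; lra.
  (* [pos] yields lower bounds of [t] and [neg] upper ones; the maximum of 0 and all lower bounds,
     formed by induction on [pos], satisfies both. *)
  have [t [t0 tpos tneg]] : exists t, [/\ 0 <= t,
      forall a, a \in pos -> dotp a x / dotp a e <= t &
      forall b, b \in neg -> t <= dotp b x / dotp b e].
    have neg0 b : b \in neg -> 0 <= dotp b x / dotp b e.
      rewrite mem_filter => /andP[b0 bh].
      by rewrite -mulrNN -invrN divr_ge0 // oppr_ge0 ?hx1 // ltW.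
    elim: (pos) hx2 => [|a l IH] hx2; first by exists 0; split.
    have [|t [t0 tl tn]] := IH.
      by move=> a' b a'l; apply: hx2; rewrite inE a'l orbT.
    exists (Num.max t (dotp a x / dotp a e)); split.
    + by rewrite le_max t0.
    + move=> a'; rewrite inE le_max => /orP[/eqP->|/tl->//].
      by rewrite lexx orbT.
    + by move=> b bn; rewrite ge_max tn // hx2 // mem_head.
  exists t, (x - t *: e); split=> //; last by rewrite addrC subrK.
  move=> a ah; rewrite dotpDr dotpNr dotpZr subr_le0.
  have [a0|a0|a0] := ltgtP (dotp a e) 0.
  + by rewrite -ler_ndivlMr // tneg // mem_filter a0.
  + by rewrite -ler_pdivrMr // tpos // mem_filter a0.
  + by rewrite a0 mulr0 hx1 // a0.
- move=> [t [y [t0 hy ->]]] c; rewrite mem_cat => /orP[|].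
    rewrite mem_filter => /andP[ce /hy cy].
    by rewrite dotpDr dotpZr; nra.
  move=> /allpairsP[[a b] /= [+ + ->]].
  rewrite !mem_filter => /andP[a0 /hy ay] /andP[b0 /hy by_].
  by rewrite dotpDl !dotpZl !dotpDr !dotpZr; nra.
Qed.

Lemma hcone_add_gcone h s : exists h', forall x,
  hcone h' x <-> exists y z, [/\ hcone h y, gcone s z & x = y + z].
Proof.
elim: s => [|e s [h1 hP]].
  exists h => x; split=> [hx|[y [z [hy -> ->]]]]; last by rewrite addr0.
  by exists x, 0; rewrite addr0.
have [h2 h2P] := hcone_add_ray h1 e.
exists h2 => x; rewrite h2P; split.
  move=> [t [_ [t0 /hP[y [z [hy hz ->]]] ->]]].
  by exists y, (t *: e + z); split=> //; [exists t, z | rewrite addrCA].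
move=> [y [_ [hy [t [z [t0 hz ->]]] ->]]].
exists t, (y + z); split=> //; last by rewrite addrCA.
by apply/hP; exists y, z.
Qed.

Lemma weyl s : exists h, hcone h = gcone s.
Proof.
(* The constraints [x i 0 <= 0] and [- x i 0 <= 0] cut out the origin, to which the generated cone
   is added. *)
pose h0 : seq 'cV[R]_p :=
  [seq delta_mx i 0 | i <- enum 'I_p] ++ [seq - delta_mx i 0 | i <- enum 'I_p].
have h0P x : hcone h0 x -> x = 0.
  move=> hx; apply/matrixP => i j; rewrite ord1 mxE; apply/eqP.
  rewrite eq_le -dotp_delta -[0 <= _]oppr_le0 -dotpNl !hx // mem_cat; apply/orP.
    by right; apply/mapP; exists i; rewrite ?mem_enum.
  by left; apply/mapP; exists i; rewrite ?mem_enum.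
have [h hP] := hcone_add_gcone h0 s.
exists h; apply/seteqP; split=> x.
  by move/hP => [y [z [/h0P-> sz ->]]]; rewrite add0r.
move=> sx; apply/hP; exists 0, x; rewrite add0r; split=> // a _.
by rewrite dotp0r.
Qed.

Lemma gcone0 s : gcone s 0.
Proof. by elim: s => //= e s IH; exists 0, 0; rewrite scale0r addr0. Qed.

Lemma mem_gcone s e : e \in s -> gcone s e.
Proof.
elim: s => //= d s IH; rewrite inE => /orP[/eqP->|/IH se].
  by exists 1, 0; rewrite scale1r addr0 ler01; split=> //; exact: gcone0.
by exists 0, e; rewrite scale0r add0r.
Qed.

Lemma gcone_ind s (A : set 'cV[R]_p) : A 0 ->
  (forall t e x, 0 <= t -> e \in s -> A x -> A (t *: e + x)) -> gcone s `<=` A.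
Proof.
move=> A0; elim: s => [_ x /= -> //|e s IH As x /= [t [y [t0 sy ->]]]].
apply: (As); rewrite ?mem_head //; apply: IH sy => u d z u0 ds.
by apply: As; rewrite // inE ds orbT.
Qed.

Lemma dotp_gcone_le0 a s x :
  (forall e, e \in s -> dotp a e <= 0) -> gcone s x -> dotp a x <= 0.
Proof.
move=> sa; move: x; apply: gcone_ind => /=; first by rewrite dotp0r.
by move=> t e x t0 /sa ae ax; rewrite dotpDr dotpZr; nra.
Qed.

(* By duality: the generators of [hcone h] are the inequalities that [weyl]
   yields for the polar cone [gcone h]. *)
Lemma minkowski h : exists s, hcone h = gcone s.
Proof.
have [d dP] := weyl h; have [g gP] := weyl d.
exists d; apply/seteqP; split=> x hx.
  rewrite -gP => a ag; rewrite dotpC.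
  apply: (dotp_gcone_le0 (s := h)) => [b bh|]; first by rewrite dotpC hx.
  rewrite -dP => e ed; rewrite dotpC.
  by have := mem_gcone ed; rewrite -gP; exact.
move=> a ah; apply: dotp_gcone_le0 hx => e ed.
by rewrite dotpC; have := mem_gcone ah; rewrite -dP; exact.
Qed.

End Cones.

(** * Homogenization of polyhedra and attainment in linear programming *)

Section Homogenization.
Variables (R : realType) (p : nat) (J : finType) (f : J -> 'cV[R]_p) (beta : J -> R).

(** Normals of the cone of pairs [(x, t)] with [0 <= t] and [dotp (f j) x <= beta j * t]; the head
    of the list encodes [0 <= t]. The slice at [t = 1] is the given polyhedron, the slice at [t = 0]
    the homogeneous system. *)
Definition homogenization : seq 'cV[R]_(p + 1) :=
  col_mx 0 (-1)%:M :: [seq col_mx (f j) (- beta j)%:M | j <- enum J].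

Lemma col_mx_scalarK (w : 'cV[R]_(p + 1)) :
  w = col_mx (usubmx w) (dsubmx w 0 0)%:M.
Proof. by rewrite -mx11_scalar vsubmxK. Qed.

Lemma dotp_col_scalar (a x : 'cV[R]_p) (u t : R) :
  dotp (col_mx a u%:M) (col_mx x t%:M) = dotp a x + u * t.
Proof. by rewrite dotp_col [dotp u%:M _]dotpE big_ord1 !mxE eqxx. Qed.

Lemma hcone_homogenization x t :
  hcone homogenization (col_mx x t%:M) <->
  0 <= t /\ forall j, dotp (f j) x <= beta j * t.
Proof.
split=> [hx|[t0 hx] a].
  split=> [|j].
    by have := hx _ (mem_head _ _); rewrite dotp_col_scalar dotp0l; lra.
  have /hx : col_mx (f j) (- beta j)%:M \in homogenization.
    by rewrite inE; apply/orP; right; apply/mapP; exists j; rewrite ?mem_enum.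
  by rewrite dotp_col_scalar; lra.
rewrite inE => /orP[/eqP->|/mapP[j _ ->]]; rewrite dotp_col_scalar ?dotp0l.
  lra.
by have := hx j; lra.
Qed.

Lemma seq_argmax (T : eqType) (s : seq T) (r : T -> R) e0 : e0 \in s ->
  exists2 e, e \in s & forall d, d \in s -> r d <= r e.
Proof.
elim: s e0 => // e [|e' s] IH e0 _.
  by exists e; rewrite ?mem_head // => d; rewrite inE => /eqP->.
have [d ds dmax] := IH e' (mem_head _ _).
have [le_de|lt_ed] := leP (r d) (r e).
  exists e; first exact: mem_head.
  by move=> c; rewrite inE => /orP[/eqP->//|/dmax/le_trans]; apply.
exists d; first by rewrite inE ds orbT.
by move=> c; rewrite inE => /orP[/eqP->|/dmax//]; exact: ltW.
Qed.

(** If no generator had positive height, neither would any element of the cone, in particular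
    [(z0, 1)]. *)
Lemma pos_generator s z0 : hcone homogenization = gcone s ->
  (forall j, dotp (f j) z0 <= beta j) -> exists2 e, e \in s & 0 < dsubmx e 0 0.
Proof.
move=> sP z0P; apply: contrapT => no_pos.
have : gcone s (col_mx z0 1%:M).
  by rewrite -sP; apply/hcone_homogenization; split=> // j; rewrite mulr1.
move/(dotp_gcone_le0 (a := col_mx 0 1%:M)).
rewrite dotp_col_scalar dotp0l add0r mulr1 ler10 => H.
suff : false by []; apply: H => e es.
rewrite [e]col_mx_scalarK dotp_col_scalar dotp0l add0r mul1r leNgt.
by apply/negP => epos; apply: no_pos; exists e.
Qed.

(** Generators of positive height, scaled to height 1, are feasible points. The best of them is
    optimal, since generators of height 0 are recession directions and do not improve [g]. *)
Lemma lp_max (g : 'cV[R]_p) z0 :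
  (forall j, dotp (f j) z0 <= beta j) ->
  (forall d, (forall j, dotp (f j) d <= 0) -> dotp g d <= 0) ->
  exists2 z, (forall j, dotp (f j) z <= beta j) &
    forall z', (forall j, dotp (f j) z' <= beta j) -> dotp g z' <= dotp g z.
Proof.
move=> z0P grec; have [s sP] := minkowski homogenization.
have sE x t : gcone s (col_mx x t%:M) <->
    0 <= t /\ forall j, dotp (f j) x <= beta j * t.
  by rewrite -sP hcone_homogenization.
have liftE z : (forall j, dotp (f j) z <= beta j) -> gcone s (col_mx z 1%:M).
  by move=> zP; apply/sE; split=> // j; rewrite mulr1.
pose ht (e : 'cV[R]_(p + 1)) := dsubmx e 0 0.
have hom e : e \in s -> 0 <= ht e /\ forall j, dotp (f j) (usubmx e) <= beta j * ht e.
  by move=> es; apply/sE; rewrite -col_mx_scalarK; exact: mem_gcone.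
have [e0 e0s e0pos] := pos_generator sP z0P.
have {e0pos}e0s : e0 \in [seq e <- s | 0 < ht e] by rewrite mem_filter e0pos.
have [e] := seq_argmax (fun e => dotp g (usubmx e) / ht e) e0s.
rewrite mem_filter => /andP[epos es] emax.
have zE a : dotp a ((ht e)^-1 *: usubmx e) = dotp a (usubmx e) / ht e.
  by rewrite dotpZr mulrC.
exists ((ht e)^-1 *: usubmx e).
  by move=> j; rewrite zE ler_pdivrMr //; have [_] := hom e es.
(* With [v] the value of [g] at the chosen point, the functional [(g, - v)] is nonpositive on every
   generator, hence at [(z, 1)]. *)
move=> z /liftE /(dotp_gcone_le0 (a := col_mx g (- (dotp g (usubmx e) / ht e))%:M)).
rewrite dotp_col_scalar zE mulr1 subr_le0; apply=> d ds.
rewrite [d]col_mx_scalarK dotp_col_scalar mulNr subr_le0 -/(ht d).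
have [] := hom d ds; rewrite le0r => /orP[/eqP->|dpos] dP.
  by rewrite mulr0; apply: grec => j; have := dP j; rewrite mulr0.
by rewrite -ler_pdivrMr // emax // mem_filter dpos.
Qed.

End Homogenization.

(** * Convex sets, convex cones and their hulls *)

Section ConvexCones.
Variables (R : realType) (V : lmodType R).
Implicit Types (A B : set V).

(** Trades the bundled unit-interval scalar and boolean membership for plain inequalities and
    predicates. *)
Lemma convex_setP A : convex_set A <->
  forall x y (t : R), 0 <= t -> t <= 1 -> A x -> A y -> A (t *: x + (1 - t) *: y).
Proof.
split=> [Ac x y t t0 t1 Ax Ay|Ac x y t].
  have := Ac x y (Itv01 t0 t1).
  by rewrite !in_setE; apply.
by rewrite !in_setE; apply: Ac.
Qed.

Lemma convex_coneD A x y : convex_cone A -> A x -> A y -> A (x + y).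
Proof.
move=> [_ /convex_setP Ac Az] Ax Ay.
have -> : x + y = 2 *: (2^-1 *: x + (1 - 2^-1) *: y).
  have -> : 1 - 2^-1 = 2^-1 :> R by lra.
  by rewrite -scalerDr scalerA divff ?scale1r ?pnatr_eq0.
by apply: Az; [lra|apply: Ac => //; lra].
Qed.

Lemma convex_hull_sub A : A `<=` convex_hull A.
Proof. exact: sub_gen_smallest. Qed.

Lemma cone_hull_sub A : A `<=` cone_hull A.
Proof. exact: sub_gen_smallest. Qed.

Lemma convex_hull_convex A : convex_set (convex_hull A).
Proof.
apply/convex_setP => x y t t0 t1 hx hy B [Bc AB].
by move/convex_setP: (Bc); apply=> //; [apply: hx|apply: hy].
Qed.

Lemma cone_hull_cone A : convex_cone (cone_hull A).
Proof.
split.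
- by move=> B [[]].
- apply/convex_setP => x y t t0 t1 hx hy B BP; have [[_ Bc _] _] := BP.
  by move/convex_setP: Bc; apply=> //; [apply: hx|apply: hy].
- by move=> t x t0 hx B BP; have [[_ _ Bz] _] := BP; apply: Bz => //; apply: hx.
Qed.

End ConvexCones.

(** * Recession cones of polyhedra and generators of polyhedral cones *)

Section Polyhedra.
Variable R : realType.

Lemma mulmxDZ_col m p (A : 'M[R]_(m, p)) (x d : 'cV_p) t i :
  (A *m (x + t *: d)) i 0 = (A *m x) i 0 + t * (A *m d) i 0.
Proof. by rewrite mulmxDr -scalemxAr [LHS]mxE; congr (_ + _); rewrite mxE. Qed.

Lemma recession_polyhedron m p (A : 'M[R]_(m, p)) (b : 'cV_m) (x0 : 'cV_p) :
  (forall i, (A *m x0) i 0 <= b i 0) ->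
  recession_cone [set x : 'cV_p | forall i, (A *m x) i 0 <= b i 0] =
  [set d : 'cV_p | forall i, (A *m d) i 0 <= 0].
Proof.
move=> x0P; apply/seteqP; split=> d /= dP i.
  rewrite leNgt; apply/negP => dpos.
  (* This step length brings row [i] to the value [b i 0 + 1] at [x0 + t *: d]. *)
  have := dP x0 ((b i 0 - (A *m x0) i 0 + 1) / (A *m d) i 0) x0P.
  rewrite divr_ge0 ?(ltW dpos) // => [/(_ isT i)|]; last first.
    by have := x0P i; lra.
  by rewrite mulmxDZ_col divfK ?gt_eqF //; lra.
by move=> t xP t0 j; rewrite mulmxDZ_col; have := xP j; have := dP j; nra.
Qed.

(** As [C] is closed under scaling, its right-hand sides can be replaced by 0; then [minkowski]
    applies. *)
Lemma polyhedral_cone_gcone p (C : set 'cV[R]_p) :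
  polyhedral_cone C -> exists s, C = gcone s.
Proof.
move=> [[m [A [b CE]]] [C0 _ Cz]].
have b0 i : 0 <= b i 0.
  by have : C 0 by []; rewrite CE => /(_ i); rewrite mulmx0 mxE.
have [s sP] := minkowski [seq (row i A)^T | i <- enum 'I_m].
exists s; rewrite -sP; apply/seteqP; split=> x.
  move=> Cx _ /mapP[i _ ->]; rewrite dotp_row leNgt; apply/negP => pos.
  have : C (((b i 0 + 1) / (A *m x) i 0) *: x).
    by apply: Cz => //; rewrite divr_ge0 ?(ltW pos) // ler_wpDr.
  rewrite CE => /(_ i); rewrite -scalemxAr mxE divfK ?gt_eqF //; lra.
move=> hx; rewrite CE => i; apply: le_trans (b0 i).
by rewrite -dotp_row hx //; apply/mapP; exists i; rewrite ?mem_enum.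
Qed.

End Polyhedra.

(** * Recession mappings and inequalities for [F x + C] *)

Section SetValuedMaps.
Variables (R : realType) (n q : nat).
Implicit Types (F : 'cV[R]_n -> set 'cV[R]_q) (C : set 'cV[R]_q).

Lemma graphE F x y : graph F (col_mx x y) = F x y.
Proof. by rewrite /graph /= col_mxKu col_mxKd. Qed.

Lemma recession_mapD F x x' y y' t : F x y -> recession_map F x' y' -> 0 <= t ->
  F (x + t *: x') (y + t *: y').
Proof.
rewrite -!(graphE F) => Fxy rec t0.
by rewrite -add_col_mx -scale_col_mx; apply: rec.
Qed.

Lemma recession_map00 F : recession_map F 0 0.
Proof. by move=> z t Fz _; rewrite col_mx0 scaler0 addr0. Qed.

Lemma recession_map_add F x x' y y' :
  recession_map F x y -> recession_map F x' y' ->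
  recession_map F (x + x') (y + y').
Proof.
move=> rec rec' z u Fz u0; rewrite -add_col_mx scalerDr addrA.
by apply: rec' => //; apply: rec.
Qed.

Lemma polyhedral_convex_recession F : polyhedral_convex F -> feasible F ->
  polyhedral_convex (recession_map F).
Proof.
move=> [m [A [b FE]]] [x0 [y0 Fxy]].
exists m, A, 0; rewrite graph_recession_map FE (recession_polyhedron (x0 := col_mx x0 y0)).
  by apply/seteqP; split=> z /= zP i; have := zP i; rewrite [(0 : 'cV_m) i 0]mxE.
by move: Fxy; rewrite -graphE FE.
Qed.

(** A cone given by homogeneous inequalities is its own recession cone. Hence results on minimizing
    points can be applied to the recession mapping, where they concern directions. *)
Lemma recession_map_idem F : polyhedral_convex F -> feasible F ->
  recession_map (recession_map F) = recession_map F.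
Proof.
move=> [m [A [b FE]]] [x0 [y0 Fxy]].
have recE : graph (recession_map F) = [set z : 'cV_(n + q) | forall i, (A *m z) i 0 <= 0].
  rewrite graph_recession_map FE (recession_polyhedron (x0 := col_mx x0 y0)) //.
  by move: Fxy; rewrite -graphE FE.
apply/funext => x; apply/seteqP; split=> y.
  move=> /(_ 0 1); rewrite add0r scale1r graphE; apply => //.
  by rewrite recE => i; rewrite mulmx0 mxE.
move=> rec z t Gz t0; move: rec; rewrite -graphE; move: Gz; rewrite recE => /= zP dP i.
by rewrite mulmxDZ_col; have := zP i; have := dP i; nra.
Qed.

Lemma gcone_map p r (g : 'cV[R]_p -> 'cV[R]_r) s : linear g ->
  gcone [seq g e | e <- s] = [set g c | c in gcone s].
Proof.
move=> g_lin; elim: s => [|e s IH] /=.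
  rewrite image_set1; congr [set _]; have := g_lin (-1) 0 0.
  by rewrite scaler0 addr0 scaleN1r addNr.
rewrite IH; apply/seteqP; split=> x.
  move=> [t [_ [t0 [c sc <-] ->]]]; exists (t *: e + c); last exact: g_lin.
  by exists t, c.
move=> [_ [t [c [t0 sc ->]]] <-]; exists t, (g c); rewrite g_lin; split=> //.
by exists c.
Qed.

(* Both systems are slices, at heights 1 and 0, of a single cone: the sum of the
   homogenized graph of [F] and of [C]. *)
Lemma upper_map_inequalities F C :
  polyhedral_convex F -> feasible F -> polyhedral_cone C ->
  exists (J : finType) (a : J -> 'cV[R]_n) (l : J -> 'cV[R]_q) (beta : J -> R),
    (forall x y, (F x :+: C) y <->
      forall j, dotp (a j) x + dotp (l j) y <= beta j) /\
    (forall x y, (recession_map F x :+: C) y <->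
      forall j, dotp (a j) x + dotp (l j) y <= 0).
Proof.
move=> [m [A [b FE]]] [x0 [y0 Fxy]] /polyhedral_cone_gcone [s ->].
have FP x y : F x y <-> forall i, (A *m col_mx x y) i 0 <= b i 0.
  by rewrite -graphE FE.
have GP x y : recession_map F x y <-> forall i, (A *m col_mx x y) i 0 <= 0.
  rewrite -graphE graph_recession_map FE (recession_polyhedron (x0 := col_mx x0 y0)) //.
  exact/FP.
(* [C] is placed at [x = 0] and height 0, so that adding it changes only [y]. *)
pose emb : 'cV[R]_q -> 'cV[R]_(n + q + 1) := fun c => col_mx (col_mx 0 c) 0.
have emb_lin : linear emb.
  move=> t c d; rewrite /emb !scale_col_mx !add_col_mx.
  by rewrite !scaler0 !addr0.
pose f i : 'cV[R]_(n + q) := (row i A)^T.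
have [h hP] := hcone_add_gcone (homogenization f (fun i => b i 0))
  [seq emb e | e <- s].
(* The slice of the sum cone at height [t]; it is used for [t = 1], which gives [F], and [t = 0],
   which gives the recession mapping. *)
have key x y t : 0 <= t -> (exists y' c,
    [/\ forall i, (A *m col_mx x y') i 0 <= b i 0 * t, gcone s c & y' + c = y]) <->
    hcone h (col_mx (col_mx x y) t%:M).
  move=> t0; rewrite hP; split.
    move=> [y' [c [y'P sc <-]]]; exists (col_mx (col_mx x y') t%:M), (emb c); split.
    - by apply/hcone_homogenization; split=> // i; rewrite /f dotp_row.
    - by rewrite gcone_map //; exists c.
    - by rewrite /emb !add_col_mx !addr0.
  move=> [u [v [hu]]]; rewrite gcone_map // => -[c sc <-] /= E.
  have {E} uE : u = col_mx (col_mx x (y - c)) t%:M.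
    apply: (addIr (emb c)); rewrite -E /emb !add_col_mx.
    by rewrite !addr0 subrK.
  exists (y - c), c; split=> //; last by rewrite subrK.
  by move: hu; rewrite uE => /hcone_homogenization[_ +] i => /(_ i); rewrite /f dotp_row.
(* The blocks of each normal [w j] are [a j], [l j] and [- beta j]. *)
pose w (j : 'I_(size h)) := tnth (in_tuple h) j.
have hE x y t : hcone h (col_mx (col_mx x y) t%:M) <-> forall j,
    dotp (usubmx (usubmx (w j))) x + dotp (dsubmx (usubmx (w j))) y <=
    - dsubmx (w j) 0 0 * t.
  have wE j : dotp (w j) (col_mx (col_mx x y) t%:M) =
      dotp (usubmx (usubmx (w j))) x + dotp (dsubmx (usubmx (w j))) y
      + dsubmx (w j) 0 0 * t.
    by rewrite {1}[w j]col_mx_scalarK dotp_col_scalar -{1}[usubmx (w j)]vsubmxK dotp_col.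
  split=> [hz j|hz _ /(tnthP (in_tuple h))[j ->]].
    by have := hz _ (mem_tnth j (in_tuple h)); rewrite -/(w j) wE; lra.
  by rewrite -/(w j) wE; have := hz j; lra.
exists 'I_(size h), (fun j => usubmx (usubmx (w j))),
  (fun j => dsubmx (usubmx (w j))), (fun j => - dsubmx (w j) 0 0).
split=> x y.
  have -> : (F x :+: gcone s) y <-> hcone h (col_mx (col_mx x y) 1%:M).
    rewrite -key //; split.
      move=> [y' Fy' [c sc <-]]; exists y', c; split=> // i.
      by rewrite mulr1; move: i; apply/FP.
    move=> [y' [c [Fy' sc <-]]]; exists y'; last by exists c.
    by apply/FP => i; rewrite -[b i 0]mulr1.
  by rewrite hE; split=> + j => /(_ j); rewrite mulr1.
have -> : (recession_map F x :+: gcone s) y <-> hcone h (col_mx (col_mx x y) 0%:M).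
  rewrite -key //; split.
    move=> [y' Gy' [c sc <-]]; exists y', c; split=> // i.
    by rewrite mulr0; move: i; apply/GP.
  move=> [y' [c [Gy' sc <-]]]; exists y'; last by exists c.
  by apply/GP => i; rewrite -(mulr0 (b i 0)).
by rewrite hE; split=> + j => /(_ j); rewrite mulr0.
Qed.

(** Here [y] witnesses that the value at [x] meets [-C]. For regular [C] this one condition replaces
    the two inclusions of the theorem, see [stableP]. *)
Definition stable F C := forall x y y',
  recession_map F x y -> C (- y) -> recession_map F x y' -> C y'.

(** * Existence of dominating minimizing points *)

Lemma stable_minimizer F C x0 : polyhedral_convex F -> polyhedral_cone C ->
  stable F C -> dom F x0 ->
  exists2 x1, F x0 :+: C `<=` F x1 :+: C & minimizing_point F C x1.
Proof.
move=> F_poly C_cone F_stable dom0.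
have Ccone := C_cone.2; have [C0 _ _] := Ccone.
have F_feas : feasible F by exists x0.
have [J [a [l [beta [FE GE]]]]] := upper_map_inequalities F_poly F_feas C_cone.
have subFC x : F x `<=` F x :+: C by move=> y Fy; exists y => //; exists 0; rewrite ?addr0.
have lC j c : C c -> dotp (l j) c <= 0.
  move=> Cc; have /GE/(_ j) : (recession_map F 0 :+: C) c.
    by exists 0; [exact: recession_map00|exists c; rewrite ?add0r].
  by rewrite dotp0r add0r.
(* The inequalities [dotp (a j) x <= 0] say that 0 lies in [G x + C], that is, [G x] meets [-C], so
   stability applies. *)
have Grec x y : (forall j, dotp (a j) x <= 0) -> (recession_map F x :+: C) y -> C y.
  move=> ax [y' Gy' [c Cc <-]]; apply: convex_coneD => //.
  have [y1 Gy1 [c1 Cc1 /eqP]] : (recession_map F x :+: C) 0.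
    by apply/GE => j; rewrite dotp0r addr0.
  rewrite addrC addr_eq0 => /eqP c1E; apply: F_stable Gy1 _ Gy'.
  by rewrite -c1E.
(* On [F x + C], [l j] reaches its largest value over all points dominating [x]. This survives the
   passage to a dominating point, so the indices can be treated in succession. *)
pose opt j x := exists2 y, (F x :+: C) y & forall x', F x :+: C `<=` F x' :+: C ->
  forall y', (F x' :+: C) y' -> dotp (l j) y' <= dotp (l j) y.
have opt_mono j x x' : F x :+: C `<=` F x' :+: C -> opt j x -> opt j x'.
  move=> sub [y Fy ymax]; exists y; first exact: sub.
  by move=> z sub'; apply: ymax => //; exact: subset_trans sub'.
have step j x : dom F x -> exists2 x', F x :+: C `<=` F x' :+: C & opt j x'.
  move=> [yx Fyx].
  pose E i := [set dotp (l i) y | y in F x :+: C].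
  have E0 i : E i !=set0 by exists (dotp (l i) yx); exists yx => //; exact: subFC.
  (* Domination of the fixed point [x] is a linear system in [x'], with the suprema of the [l i]
     over [F x + C] as data. *)
  have EP x' : F x :+: C `<=` F x' :+: C <->
      forall i, dotp (a i) x' <= beta i - sup (E i).
    split=> [sub i|x'P y Fy].
      suff : sup (E i) <= beta i - dotp (a i) x' by lra.
      apply: ge_sup => // _ [y Fy <-].
      by have /FE/(_ i) := sub _ Fy; lra.
    apply/FE => i; have := x'P i.
    suff : dotp (l i) y <= sup (E i) by lra.
    apply: ub_le_sup; last by exists y.
    exists (beta i - dotp (a i) x) => _ [z Fz <-].
    by have /FE/(_ i) := Fz; lra.
  pose f (k : J + J) : 'cV[R]_(n + q) :=
    match k with inl i => col_mx (a i) 0 | inr i => col_mx (a i) (l i) end.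
  pose gam (k : J + J) :=
    match k with inl i => beta i - sup (E i) | inr i => beta i end.
  have fP x' y : (forall k, dotp (f k) (col_mx x' y) <= gam k) <->
      F x :+: C `<=` F x' :+: C /\ (F x' :+: C) y.
    rewrite EP FE; split=> [kP|[lP rP] [i|i]] /=; rewrite ?dotp_col ?dotp0l ?addr0 //.
    by split=> i; [have := kP (inl i)|have := kP (inr i)]; rewrite dotp_col ?dotp0l ?addr0.
  have [|d dP|z zP zmax] := @lp_max R _ _ f gam (col_mx 0 (l j)) (col_mx x yx).
  - by apply/fP; split=> //; exact: subFC.
  (* For a recession direction of this program, [Grec] puts the [y]-part in [C], where [l j] is
     nonpositive. *)
  - rewrite -[d]vsubmxK dotp_col dotp0l add0r; apply: lC.
    have dP' k : dotp (f k) (col_mx (usubmx d) (dsubmx d)) <= 0 by rewrite vsubmxK.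
    apply: (Grec (usubmx d)) => [i|].
      by have := dP' (inl i); rewrite dotp_col dotp0l addr0.
    by apply/GE => i; have := dP' (inr i); rewrite dotp_col.
  move: zP zmax; rewrite -[z]vsubmxK => /fP[sub Fz] zmax.
  exists (usubmx z) => //; exists (dsubmx z) => // x' sub' y' Fy'.
  have := zmax (col_mx x' y'); rewrite !dotp_col !dotp0l !add0r; apply.
  by apply/fP; split=> //; exact: subset_trans sub'.
have dom_sub x x' : dom F x -> F x :+: C `<=` F x' :+: C -> dom F x'.
  by move=> [y /subFC Fy] /(_ _ Fy) [y' Fy' _]; exists y'.
have [x1 sub1 opt1] : exists2 x1, F x0 :+: C `<=` F x1 :+: C &
    forall j, j \in enum J -> opt j x1.
  elim: (enum J) => [|j js [x1 sub1 opt1]]; first by exists x0.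
  have [x2 sub2 opt2] := step j x1 (dom_sub _ _ dom0 sub1).
  exists x2; first exact: subset_trans sub2.
  move=> i; rewrite inE => /orP[/eqP->//|/opt1]; exact: opt_mono.
exists x1 => //; split; first exact: dom_sub sub1.
(* For [y] in [F x2 + C], optimality bounds [l j] at [y] by its value at some [z] in [F x1 + C], so
   [y] satisfies the inequalities for [x1]. *)
move=> [x2 [sub]]; apply=> y Fy; apply/FE => j.
have [z /FE/(_ j) Fz zmax] := opt1 j (mem_enum _ _).
by have := zmax _ sub _ Fy; lra.
Qed.

(** * Necessity of the stability condition *)

Lemma minimizing_point_stable F C x0 : polyhedral_convex F -> polyhedral_cone C ->
  recession_map F 0 `<=` C -> minimizing_point F C x0 -> stable F C.
Proof.
move=> F_poly C_cone G0C [[f Ff] min0] x y y' Gy Cy Gy'.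
have Ccone := C_cone.2; have [C0 _ Cz] := Ccone.
have F_feas : feasible F by exists x0, f.
have [J [a [l [beta [FE GE]]]]] := upper_map_inequalities F_poly F_feas C_cone.
(* Writing [f' + c] as [(f' + t *: y) + (c - t *: y)] shows that [x0 + t *: x] dominates [x0]; a
   missing point of the ray would make the domination strict. *)
have ray t : 0 <= t -> (F x0 :+: C) (f + t *: y').
  move=> t0; apply: contrapT => not_in; apply: min0; exists (x0 + t *: x); split.
    move=> _ [f' Ff' [c Cc <-]].
    exists (f' + t *: y); first exact: recession_mapD.
    exists (c + t *: - y); first by apply: convex_coneD => //; exact: Cz.
    by rewrite addrACA -scalerDr subrr scaler0 addr0.
  move/(_ (f + t *: y')) => sub; apply/not_in/sub.
  by exists (f + t *: y'); [exact: recession_mapD|exists 0; rewrite ?addr0].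
suff [z /G0C Cz' [c Cc <-]] : (recession_map F 0 :+: C) y' by exact: convex_coneD.
apply/GE => j; rewrite dotp0r add0r leNgt; apply/negP => pos.
have ray0 : dotp (a j) x0 + dotp (l j) f <= beta j.
  by have /FE := ray _ (lexx 0); rewrite scale0r addr0; apply.
(* Chosen so that inequality [j] would read [beta j + 1 <= beta j] on the ray. *)
pose t := (beta j - dotp (a j) x0 - dotp (l j) f + 1) / dotp (l j) y'.
have t0 : 0 <= t by rewrite divr_ge0 ?(ltW pos) //; lra.
have /FE/(_ j) := ray t t0.
by rewrite dotpDr dotpZr /t divfK ?gt_eqF //; lra.
Qed.

(** For the converse, the first inclusion puts [y] in [C], so [- y] is in the lineality space and,
    by regularity, in [G 0]. Adding it to [y] gives 0 in [G x], so [G x] lies in the natural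
    cone. *)
Lemma stableP F C : polyhedral_cone C -> regular F C ->
  stable F C <->
  set_opp C `&` (C :+: \bigcup_x recession_map F x) `<=` C /\ natural_cone F `<=` C.
Proof.
move=> [_ Ccone] [linC G0C]; have [C0 _ _] := Ccone; split=> [st|[QC KC] x y y' Gy Cy Gy'].
  split=> [_ [[z Cz <-] [c Cc [y [x _ Gy]] E]]|y [x [Gy G0]]]; last first.
    by apply: st G0 _ Gy; rewrite oppr0.
  rewrite -E; apply: convex_coneD => //; apply: st (Gy) _ Gy.
  have -> : - y = c + z by rewrite -[z]opprK -E opprD addrA subrr add0r.
  exact: convex_coneD.
have Cyy : C y.
  apply: QC; split; first by exists (- y); rewrite ?opprK.
  by exists 0 => //; exists y; rewrite ?add0r //; exists x.
have Gny : recession_map F 0 (- y).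
  by apply: linC; split=> //; exists y.
apply: KC; exists x; split=> //.
by have := recession_map_add Gy Gny; rewrite addr0 subrr.
Qed.

(** * Construction of a solution from generators of the homogenized graph *)

Lemma stable_solution F C : polyhedral_convex F -> polyhedral_cone C ->
  regular F C -> feasible F -> stable F C -> exists Sp Sd, solution F C Sp Sd.
Proof.
move=> F_poly C_cone [_ G0C] F_feas F_stable.
have Ccone := C_cone.2; have [C0 Cconv Cz] := Ccone.
pose G := recession_map F.
have G_poly : polyhedral_convex G := polyhedral_convex_recession F_poly F_feas.
have G_stable : stable G C.
  by rewrite /stable /G recession_map_idem.
(* Needed for [F] and for [G]; outside the domain the chosen value is arbitrary. *)
have choice_min H : polyhedral_convex H -> stable H C ->
    exists mp, forall x, dom H x ->
      H x :+: C `<=` H (mp x) :+: C /\ minimizing_point H C (mp x).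
  move=> H_poly H_stable.
  suff /choice[mp mpP] : forall x, exists x', dom H x ->
      H x :+: C `<=` H x' :+: C /\ minimizing_point H C x' by exists mp.
  move=> x; have [Dx|nDx] := pselect (dom H x); last by exists x.
  by have [x1 ? ?] := stable_minimizer H_poly C_cone H_stable Dx; exists x1.
have [mp mpP] := choice_min F F_poly F_stable.
have [md mdP] := choice_min G G_poly G_stable.
have [m [A [b FE]]] := F_poly.
have FP x y : F x y <-> forall i, (A *m col_mx x y) i 0 <= b i 0.
  by rewrite -graphE FE.
have [x0 [y0 Fxy0]] := F_feas.
have GP x y : G x y <-> forall i, (A *m col_mx x y) i 0 <= 0.
  rewrite -graphE graph_recession_map FE (recession_polyhedron (x0 := col_mx x0 y0)) //.
  exact/FP.
pose f i : 'cV[R]_(n + q) := (row i A)^T.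
have [s sP] := minkowski (homogenization f (fun i => b i 0)).
pose ht (e : 'cV[R]_(n + q + 1)) := dsubmx e 0 0.
pose ex (e : 'cV[R]_(n + q + 1)) := usubmx (usubmx e).
pose ey (e : 'cV[R]_(n + q + 1)) := dsubmx (usubmx e).
have eE e : e = col_mx (col_mx (ex e) (ey e)) (ht e)%:M.
  by rewrite /ex /ey vsubmxK -col_mx_scalarK.
have sE x y t : gcone s (col_mx (col_mx x y) t%:M) <->
    0 <= t /\ forall i, (A *m col_mx x y) i 0 <= b i 0 * t.
  by rewrite -sP hcone_homogenization; split=> -[t0 xyP]; split=> // i;
    have := xyP i; rewrite /f dotp_row.
have sF e : e \in s -> 0 < ht e -> F ((ht e)^-1 *: ex e) ((ht e)^-1 *: ey e).
  move=> /mem_gcone; rewrite {1}[e]eE => /sE [_ eP] pos.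
  by apply/FP => i; rewrite -scale_col_mx -scalemxAr mxE mulrC ler_pdivrMr.
have sG e : e \in s -> ht e = 0 -> G (ex e) (ey e).
  move=> /mem_gcone; rewrite {1}[e]eE => /sE [_ eP] ht0.
  by apply/GP => i; have := eP i; rewrite ht0 mulr0.
pose pos := [set e | e \in s /\ 0 < ht e].
(* Generators with [G (ex e)] inside [C] are dropped: [C] already covers them, and their dominating
   direction could be 0. *)
pose dir := [set e | e \in s /\ ht e = 0 /\ ~ (G (ex e) `<=` C)].
have domF e : pos e -> dom F ((ht e)^-1 *: ex e).
  by move=> [es epos]; exists ((ht e)^-1 *: ey e); exact: sF.
have domG e : dir e -> dom G (ex e).
  by move=> [es [e0 _]]; exists (ey e); exact: sG.
pose Sp := [set mp ((ht e)^-1 *: ex e) | e in pos].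
pose Sd := [set md (ex e) | e in dir].
have subC (H : 'cV[R]_n -> set 'cV[R]_q) x : H x `<=` H x :+: C.
  by move=> y Hy; exists y => //; exists 0; rewrite ?addr0.
have Sp_min x : Sp x -> minimizing_point F C x.
  by move=> [e /domF De <-]; exact: (mpP _ De).2.
have Sd_min x : Sd x -> minimizing_direction F C x.
  move=> [e dire <-]; have [sub [Dmd min]] := mdP _ (domG e dire).
  (* If the direction were 0, then [G (ex e)] would lie in [G 0 + C], hence in [C]. *)
  split=> //; apply/eqP => md0; have [_ [_]] := dire; apply => y /subC /sub.
  by rewrite md0 => -[y' /G0C Cy' [c Cc <-]]; exact: convex_coneD.
have [e1 e1s e1pos] : exists2 e, e \in s & 0 < ht e.
  apply: (pos_generator sP (z0 := col_mx x0 y0)) => i.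
  by rewrite /f dotp_row; move: i; apply/FP.
have finite_s (P : set 'cV[R]_(n + q + 1)) : (forall e, P e -> e \in s) -> finite_set P.
  by move=> Ps; apply: (sub_finite_set (B := [set` s])) => [e /Ps //|]; exact: finite_seq.
exists Sp, Sd; split=> //; split.
- by split; apply: finite_image; apply: finite_s => e [].
- by split=> [x /Sp_min[]//|]; exists (mp ((ht e1)^-1 *: ex e1)), e1.
- by move=> x /Sd_min [x_neq0 Dx _]; split=> //; exact/eqP.
set U := \bigcup_(x in Sp) F x; set W := \bigcup_(x in Sd) recession_map F x.
have Kcone := cone_hull_cone W; have [K0 _ Kz] := Kcone.
have Uconv := (convex_setP _).1 (@convex_hull_convex R _ U).
(* Homogeneous form of the infimizer inclusion: it is preserved by conic combinations and gives the
   inclusion itself at height 1. *)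
pose dec z := 0 <= ht z /\ exists c u k,
  [/\ C c, convex_hull U u, cone_hull W k & ey z = c + ht z *: u + k].
have subU e : pos e -> F (mp ((ht e)^-1 *: ex e)) `<=` U.
  by move=> pe y Fy; exists (mp ((ht e)^-1 *: ex e)) => //; exists e.
have [u0 Uu0] : convex_hull U !=set0.
  have p1 : pos e1 by [].
  have [_ [[y Fy] _]] := mpP _ (domF _ p1).
  by exists y; apply: convex_hull_sub; exact: (subU _ p1).
have dec_gen e : e \in s -> dec e.
  move=> es; have [ht0 _] : 0 <= ht e /\ forall i, (A *m col_mx (ex e) (ey e)) i 0 <= b i 0 * ht e.
    by apply/sE; rewrite -eE; exact: mem_gcone.
  split=> //; move: ht0; rewrite le0r => /orP[/eqP e0|epos].
    have Gy := sG _ es e0; have [GC|nGC] := pselect (G (ex e) `<=` C).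
      (* At height 0 the hull point has weight 0, so [u0] is a mere placeholder. *)
      by exists (ey e), u0, 0; rewrite e0 scale0r !addr0; split=> //; exact: GC.
    have dire : dir e by [].
    have [/(_ _ (subC _ _ _ Gy)) [k Gk [c Cc kc]] _] := mdP _ (domG _ dire).
    exists c, u0, k; rewrite e0 scale0r addr0 addrC kc; split=> //.
    by apply: cone_hull_sub; exists (md (ex e)) => //; exists e.
  have pe : pos e by [].
  have [/(_ _ (subC _ _ _ (sF _ es epos))) [u Fu [c Cc uc]] _] := mpP _ (domF _ pe).
  exists (ht e *: c), u, 0; split=> //.
  - by apply: Cz => //; exact: ltW.
  - by apply: convex_hull_sub; exact: (subU _ pe).
  - by rewrite addr0 -scalerDr addrC uc scalerA divff ?scale1r // gt_eqF.
have htP t e z : ht (t *: e + z) = t * ht e + ht z by rewrite /ht !mxE.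
have eyP t e z : ey (t *: e + z) = t *: ey e + ey z by rewrite /ey !linearP.
have dec_s : gcone s `<=` dec.
  apply: gcone_ind => [|t e z t0 es [z0 [c' [u' [k' [Cc' Uu' Kk' eyz]]]]]].
    split; first by rewrite /ht !mxE.
    exists 0, u0, 0; split=> //.
    by rewrite /ey /ht !linear0 mxE scale0r !addr0.
  have [e0 [c [u [k [Cc Uu Kk eye]]]]] := dec_gen _ es.
  have te0 : 0 <= t * ht e by exact: mulr_ge0.
  split; first by rewrite htP addr_ge0.
  (* The hull points are averaged with weights proportional to the heights; if both heights vanish,
     any hull point serves. *)
  have [v Uv vE] : exists2 v, convex_hull U v &
      (t * ht e + ht z) *: v = (t * ht e) *: u + ht z *: u'.
    have [sum0|sum_neq0] := eqVneq (t * ht e + ht z) 0.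
      have [-> ->] : t * ht e = 0 /\ ht z = 0 by lra.
      by exists u => //; rewrite addr0 !scale0r addr0.
    have sum_gt0 : 0 < t * ht e + ht z by rewrite lt_def sum_neq0 addr_ge0.
    pose r := t * ht e / (t * ht e + ht z).
    exists (r *: u + (1 - r) *: u').
      apply: (Uconv u u' r) => //; rewrite /r; first by rewrite divr_ge0 // ltW.
      by rewrite ler_pdivrMr // mul1r lerDl.
    rewrite scalerDr !scalerA /r; congr (_ *: _ + _ *: _); field=> //.
  exists (t *: c + c'), v, (t *: k + k'); split=> //.
  - by apply: convex_coneD => //; exact: Cz.
  - by apply: (convex_coneD Kcone) => //; exact: Kz.
  rewrite htP eyP vE eye eyz !scalerDr scalerA.
  by rewrite [LHS]addrACA; congr (_ + _); rewrite addrACA.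
move=> _ [c Cc [y [x _ Fxy] <-]].
have /dec_s [_ [c' [u [k [Cc' Uu Kk]]]]] : gcone s (col_mx (col_mx x y) 1%:M).
  by apply/sE; split=> // i; rewrite mulr1; move: i; apply/FP.
rewrite /ey /ht col_mxKu !col_mxKd mxE eqxx scale1r => ->.
exists (c + c' + u); last by exists k; rewrite // !addrA.
by exists (c + c'); [exact: convex_coneD|exists u].
Qed.

End SetValuedMaps.

Theorem theorem3p4 (R : realType) (n q : nat)
    (F : 'cV[R]_n -> set 'cV[R]_q) (C : set 'cV[R]_q)
    (F_poly : polyhedral_convex F) (C_cone : polyhedral_cone C)
    (C_regular : regular F C) :
  (exists Sp Sd : set 'cV[R]_n, solution F C Sp Sd) <->
  [/\ feasible F,
      set_opp C `&` (C :+: \bigcup_x recession_map F x) `<=` C &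
      natural_cone F `<=` C].
Proof.
have st := stableP C_cone C_regular; split.
  move=> [Sp [Sd [[_ [Sp_dom [x Spx]] _ _] Sp_min _]]].
  have [] := st.1 (minimizing_point_stable F_poly C_cone C_regular.2 (Sp_min _ Spx)).
  by split=> //; exists x; exact: Sp_dom.
by move=> [F_feas QC KC]; apply: stable_solution => //; apply/st.
Qed.
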